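(* For $n\geq 1$, $$f_n(312,213,123)=\sum_{k=1}^n \mathcal{B}(k)\,c(n,k).$$
   Context: A forest on $[n]$ is an unordered rooted forest whose $n$ vertices are labeled bijectively by $[n]$. A forest avoids a pattern $\sigma$ if for every vertex $v$, the sequence of labels along the path from the root of the tree containing $v$ down to $v$ contains no subsequence in the same relative order as $\sigma$. $f_n(\sigma_1,\ldots,\sigma_m)$ is the number of forests on $[n]$ avoiding every $\sigma_i$. $\mathcal{B}(k)$ is the $k$th Bell number and $c(n,k)$ the unsigned Stirling number of the first kind (number of permutations of $[n]$ with exactly $k$ cycles). *)

(* Defs.v *)
From HB Require Import structures.
From mathcomp Require Import all_boot all_fingroup.

Set Implicit Arguments.
Unset Strict Implicit.
Unset Printing Implicit Defensive.

(* The vertices of a forest are identified with their labels, and the label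
   set [n] is 'I_n = {0, ..., n-1}, which only shifts the labels by one and
   leaves their relative order unchanged. *)

(* An unordered rooted forest is its parent function [p], roots having parent
   [None].  Then [ancestor p v k] is the vertex k steps above v, if any. *)
Definition ancestor n (p : {ffun 'I_n -> option 'I_n}) (v : 'I_n) (k : nat)
  : option 'I_n := iter k (obind p) (Some v).

(* A parent function is a forest when going up from any vertex leads past a
   root; a path has at most n vertices, so this takes at most n steps. *)
Definition is_forest n (p : {ffun 'I_n -> option 'I_n}) : bool :=
  [forall v, ancestor p v n == None].

Record forest n := Forest {
  parent :> {ffun 'I_n -> option 'I_n};
  _ : is_forest parent }.

HB.instance Definition _ n := [isSub for @parent n].
HB.instance Definition _ n := [Countable of forest n by <:].
HB.instance Definition _ n := [Finite of forest n by <:].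

(* Labels along the path from the root down to v. *)
Definition root_path n (F : forest n) (v : 'I_n) : seq nat :=
  rev [seq val u | u <- pmap (ancestor F v) (iota 0 n)].

Definition same_relative_order (s t : seq nat) : bool :=
  (size s == size t) &&
  [forall i : 'I_(size s), forall j : 'I_(size s),
     (nth 0 s i < nth 0 s j) == (nth 0 t i < nth 0 t j)].

(* The subsequences of s are the [mask m s] with m of the same length as s. *)
Definition contains_pattern (s sigma : seq nat) : bool :=
  [exists m : (size s).-tuple bool, same_relative_order (mask m s) sigma].

Definition avoids n (F : forest n) (sigma : seq nat) : bool :=
  [forall v, ~~ contains_pattern (root_path F v) sigma].

Definition num_avoiding_forests n (sigmas : seq (seq nat)) : nat :=
  #|[set F : forest n | all (avoids F) sigmas]|.

Definition bell k : nat :=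
  #|[set P : {set {set 'I_k}} | partition P [set: 'I_k]]|.

(* [porbits s] includes the singleton cycles of the fixed points of s. *)
Definition stirling1 n k : nat := #|[set s : 'S_n | #|porbits s| == k]|.

(* Main.v *)
Require Import Defs.
From mathcomp Require Import all_boot all_fingroup.
From mathcomp Require Import zify.

Set Implicit Arguments.
Unset Strict Implicit.
Unset Printing Implicit Defensive.

(* The three patterns are exactly those of length 3 ending in an ascent, so a
   forest avoids them iff every path decreases once its root is dropped, i.e.
   iff each non-root v hangs from a root or from a larger non-root.  For a given
   set of r roots the parents can then be chosen independently, in
   r (r+1) ... (n-1) ways, so that f_n is the sum over r of the Lah numbers
   L(n,r) = C(n,r) (n-1)^_(n-r).
   On the other side, expanding x (x+1) ... (x+n-1) = sum_k c(n,k) x^k with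
   x^k = sum_r S(k,r) x^_r, and comparing with the Vandermonde expansion
   sum_r L(n,r) x^_r, gives L(n,r) = sum_k c(n,k) S(k,r); summing over r turns
   S(k,r) into the Bell numbers. *)

(** * Rising and falling factorials *)

Lemma rising_ffact x n : \prod_(i < n) (x + i) = (x + n).-1 ^_ n.
Proof.
elim: n => [|n IHn]; first by rewrite big_ord0.
by rewrite big_ord_recr IHn /= addnS /= ffactnS mulnC.
Qed.

(** Vandermonde for C(x+n-1, n), multiplied by n! = C(n,r) r! (n-r)! in the term of index r. *)
Lemma rising_to_falling n x : 0 < n ->
  \prod_(i < n) (x + i) =
  \sum_(r < n.+1) 'C(n, r) * n.-1 ^_ (n - r) * x ^_ r.
Proof.
case: n => // n _; rewrite rising_ffact addnS -pred_Sn -bin_ffact.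
rewrite -Vandermonde big_distrl; apply: eq_bigr => -[r /= lt_rn] _.
rewrite -(bin_fact (ltnSE lt_rn : r <= n.+1)) -!bin_ffact; lia.
Qed.

(* Evaluating at x = r kills the terms of index above r. *)
Lemma falling_basis_inj n (a b : nat -> nat) :
  (forall x, \sum_(r < n) a r * x ^_ r = \sum_(r < n) b r * x ^_ r) ->
  forall r, r < n -> a r = b r.
Proof.
move=> eq_ab r; elim/ltn_ind: r => r IHr lt_rn.
have trunc (c : nat -> nat) :
    \sum_(i < n) c i * r ^_ i = \sum_(i < r) c i * r ^_ i + c r * r`!.
  rewrite -ffactnn -(big_ord_recr r (fun i => c i * r ^_ i)).
  rewrite (big_ord_widen n (fun i => c i * r ^_ i) lt_rn) [in RHS]big_mkcond.
    apply: eq_bigr => i _; case: ifP => // /negbT; rewrite -ltnNge => lt_ri.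
  by rewrite ffact_small ?muln0.
have := eq_ab r; rewrite !trunc (eq_bigr (fun i : 'I_r => b i * r ^_ i)).
  by move/addnI/eqP; rewrite eqn_pmul2r ?fact_gt0 // => /eqP.
by move=> i _; rewrite IHr ?(ltn_trans _ lt_rn).
Qed.

(** * Permutations by number of cycles *)

Lemma card_porbits_lift_perm n (s : 'S_n) :
  #|porbits (lift_perm ord0 ord0 s)| = #|porbits s|.+1.
Proof.
set s1 := lift_perm ord0 ord0 s.
have powE i : (s1 ^+ i)%g = lift_perm ord0 ord0 (s ^+ i)%g.
  elim: i => [|i IHi]; first by rewrite !expg0 lift_perm1.
  by rewrite !expgS IHi lift_permM.
have fix0 i : (s1 ^+ i)%g ord0 = ord0 by rewrite powE lift_perm_id.
have orb0 : porbit s1 ord0 = [set ord0].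
  apply/setP => x; rewrite inE; apply/porbitP/eqP => [[i ->]|->] //.
  by exists 0; rewrite expg0 perm1.
have orbS x : porbit s1 (lift ord0 x) = lift ord0 @: porbit s x.
  apply/setP => y; apply/porbitP/imsetP => [[i ->]|[z /porbitP[i ->] ->]].
    by rewrite powE lift_perm_lift; exists ((s ^+ i)%g x); rewrite ?mem_porbit.
  by exists i; rewrite powE lift_perm_lift.
have -> : porbits s1 =
    [set ord0] |: (fun B : {set _} => lift ord0 @: B) @: porbits s.
  apply/setP => B; rewrite in_setU1; apply/imsetP/predU1P.
    case=> x _ ->; case: (unliftP ord0 x) => [y|] ->; last by left.
    by right; rewrite orbS; apply/imsetP; exists (porbit s y); rewrite ?imset_f.
  case=> [->|/imsetP[C /imsetP[x _ ->] ->]]; first by exists ord0.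
  by exists (lift ord0 x).
rewrite cardsU1 card_imset; last exact/imset_inj/lift_inj.
case: imsetP => // -[B _ /setP/(_ ord0)]; rewrite set11.
by case/esym/imsetP => x _ /eqP; rewrite (negPf (neq_lift _ _)).
Qed.

(* Each permutation of 'I_n.+1 is uniquely [tperm 0 j * s] with [s] fixing 0;
   for j > 0 the transposition merges the cycle of 0 into that of j. *)
Lemma sum_exp_card_porbits n x :
  \sum_(s : 'S_n) x ^ #|porbits s| = \prod_(i < n) (x + i).
Proof.
elim: n => [|n IHn].
  rewrite big_ord0 (eq_bigr (fun=> 1)) => [|s _]; last first.
    suff -> : porbits s = set0 by rewrite cards0.
    by apply/setP => B; rewrite inE; apply/imsetP => -[[]].
  by rewrite sum1_card card_Sn.
pose f (u : 'I_n.+1 * 'S_n) := (tperm ord0 u.1 * lift_perm ord0 ord0 u.2)%g.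
have f_inj : injective f.
  move=> [i s] [j t] /= eq_f; have eq_ij : i = j.
    (* The transposition acts first, so [i] is the preimage of 0 under [f (i, s)]. *)
    apply: (@perm_inj _ (f (i, s))); rewrite [in RHS]eq_f !permM /=.
    by rewrite !tpermR !lift_perm_id.
  subst j; congr (_, _); apply/permP => y; apply: (@lift_inj _ ord0).
  by rewrite -!(lift_perm_lift ord0) (mulgI _ _ _ eq_f).
have f_bij : bijective f.
  by apply: inj_card_bij f_inj _; rewrite card_prod !card_Sn card_ord factS.
rewrite (reindex f) /=; last exact: onW_bij.
rewrite -(pair_bigA _ (fun j s => x ^ #|porbits (f (j, s))|)) /=.
(* For j = 0 the fixed point 0 is one more cycle, whence a factor x; each of the n other j leaves as
   many cycles as [s] has. *)
rewrite big_ord_recl big_ord_recr -IHn /= mulnC mulnDl; congr (_ + _).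
  rewrite big_distrr; apply: eq_bigr => s _.
  by rewrite /f tperm1 mul1g card_porbits_lift_perm expnS.
transitivity (\sum_(j < n) \sum_(s : 'S_n) x ^ #|porbits s|); last first.
  by rewrite sum_nat_const card_ord.
apply: eq_bigr => j _; apply: eq_bigr => s _; congr (x ^ _).
have := porbits_mul_tperm (lift_perm ord0 ord0 s) ord0 (lift ord0 j).
rewrite /f /= card_porbits_lift_perm.
suff -> : ord0 \notin porbit (lift_perm ord0 ord0 s) (lift ord0 j).
  by rewrite addn1 -[_.+2]addn2 => /addIn.
rewrite porbit_sym; apply/porbitP => -[i].
suff -> : (lift_perm ord0 ord0 s ^+ i)%g ord0 = ord0.
  by move/eqP; rewrite eq_sym (negPf (neq_lift _ _)).
by elim: i => [|i IHi]; rewrite ?expg0 ?perm1 // expgSr permM IHi lift_perm_id.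
Qed.

(** * Functions by their fibers *)

(* Functions T -> 'I_x whose fibers form the partition P are the injections
   from P to 'I_x. *)
Lemma sum_ffact_card_partition (T : finType) x :
  \sum_(P | partition P [set: T]) x ^_ #|P| = x ^ #|T|.
Proof.
rewrite -[x in RHS]card_ord -card_ffun -sum1_card.
rewrite (partition_big (fun f : {ffun T -> 'I_x} => preim_partition f [set: T])
  (fun P => partition P [set: T])) /=; last first.
  by move=> f _; apply: preim_partitionP.
apply: eq_bigr => P partP; rewrite sum1dep_card.
have [/eqP covP tiP nz] := and3P partP.
have inP y : pblock P y \in P by rewrite pblock_mem // covP.
have pick_block (B : {B | B \in P}) : exists y, y \in sval B.
  by apply/set0Pn; case: B => B PB /=; apply: contraNneq nz => <-.
(* Evaluating at a representative of each block inverts [h], which extends a coloring of the blocks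
   to their elements. *)
pose elt B := xchoose (pick_block B).
have eltP B : pblock P (elt B) = sval B.
  by apply: def_pblock; rewrite ?(valP B) ?(xchooseP (pick_block B)).
pose h (g : {ffun {B | B \in P} -> 'I_x}) :=
  [ffun y => g (exist (fun B => B \in P) _ (inP y))].
have h_elt g B : h g (elt B) = g B.
  by rewrite ffunE; congr (g _); apply: val_inj; rewrite /= eltP.
have h_inj : injective h.
  by move=> g1 g2 eq_h; apply/ffunP => B; rewrite -!h_elt eq_h.
have -> : [set f : {ffun T -> 'I_x} | preim_partition f [set: T] == P]
        = h @: [set g : {ffun {B | B \in P} -> 'I_x} | injectiveb g].
  apply/setP => f; rewrite inE; apply/eqP/imsetP => [kerf | [g + ->]].
    have eqf y z : (f y == f z) = (pblock P y == pblock P z).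
      rewrite -kerf.
      have tif := partition_trivIset (preim_partitionP f [set: T]).
      rewrite eq_pblock ?kerf ?covP // -kerf.
      rewrite pblock_equivalence_partition //.
      by split=> // /eqP ->.
    exists [ffun B => f (elt B)]; last first.
      by apply/ffunP => y; rewrite !ffunE; apply/eqP; rewrite eqf eltP.
    rewrite inE; apply/injectiveP => B C; rewrite !ffunE => /eqP.
    by rewrite eqf !eltP => /eqP; apply: val_inj.
  rewrite inE => /injectiveP g_inj.
  rewrite -[RHS](preim_partition_pblock partP).
  apply: eq_in_imset => y _; apply/setP => z; rewrite !inE !ffunE.
  by apply/eqP/eqP => [/g_inj[]|] // eqyz; congr (g _); apply: val_inj.
by rewrite card_imset // card_inj_ffuns card_ord card_sig.
Qed.

(** * Root paths and pattern avoidance *)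

Lemma ancestorS n (p : {ffun 'I_n -> option 'I_n}) v k :
  ancestor p v k.+1 = obind (fun u => ancestor p u k) (p v).
Proof.
rewrite /ancestor iterSr /=; case: (p v) => //=.
by elim: k => //= k ->.
Qed.

Lemma contains_patternP s sigma :
  reflect (exists2 t, subseq t s & same_relative_order t sigma)
          (contains_pattern s sigma).
Proof.
apply: (iffP existsP) => [[m ord_t]|[t /subseqP[m sz_m ->] ord_t]].
  by exists (mask m s); rewrite ?mask_subseq.
by exists (tcast sz_m (in_tuple m)); rewrite val_tcast.
Qed.

Lemma same_relative_order3 x y z a b c :
  same_relative_order [:: x; y; z] [:: a; b; c] =
  [&& (x < y) == (a < b), (x < z) == (a < c), (y < x) == (b < a),
      (y < z) == (b < c), (z < x) == (c < a) & (z < y) == (c < b)].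
Proof.
apply/idP/idP => [/andP[_ /forallP ord]|ord].
  have ord_ij (i j : 'I_3) := forallP (ord i) j.
  have := (ord_ij (inord 0) (inord 1), ord_ij (inord 0) (inord 2),
           ord_ij (inord 1) (inord 0), ord_ij (inord 1) (inord 2),
           ord_ij (inord 2) (inord 0), ord_ij (inord 2) (inord 1)).
  by rewrite !inordK //= => -[[[[[-> ->] ->] ->] ->] ->].
apply/andP; split=> //; apply/'forall_forallP.
move=> -[[|[|[|//]]] i] [[|[|[|//]]] j];
  move: ord; rewrite /= ?ltnn //; lia.
Qed.

Section Forest.
Variables (n : nat) (F : forest n).
Implicit Types u v w : 'I_n.

Lemma ancestor_size v : ancestor F v n = None.
Proof. by apply/eqP; have /forallP := valP F. Qed.

(** A cycle would bring [v] back at height n (k+1) >= n, where no ancestor is left. *)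
Lemma ancestor_acyclic v k : ancestor F v k.+1 != Some v.
Proof.
apply/eqP => eq_v.
have loop m : ancestor F v (m * k.+1) = Some v.
  by elim: m => // m IHm; rewrite mulSn /ancestor iterD [iter (_ * _) _ _]IHm.
have := loop n; rewrite mulnS addnC /ancestor iterD [iter n _ _]ancestor_size.
suff -> : iter (n * k) (obind F) None = None by [].
by elim: (n * k) => //= m ->.
Qed.

Lemma root_path_root v : F v = None -> root_path F v = [:: val v].
Proof.
case: n F v => [|m] G v Gv; first by case: v Gv.
rewrite /root_path /= /rev /=.
suff -> : pmap (ancestor G v) (iota 1 m) = [::] by [].
rewrite (iotaDl 1 0); elim: (iota 0 m) => //= i s ->.
by rewrite -[obind _ _]/(ancestor G v i.+1) ancestorS Gv.
Qed.

Lemma root_path_child v u :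
  F v = Some u -> root_path F v = rcons (root_path F u) v.
Proof.
move=> Fv; have := ancestor_size v => top_v.
suff path_v :
    pmap (ancestor F v) (iota 0 n) = v :: pmap (ancestor F u) (iota 0 n).
  by rewrite /root_path path_v -rev_cons.
case: n F v u Fv top_v => [|m] G v u Gv; first by case: v Gv.
rewrite ancestorS Gv /= => top_u. congr (_ :: _).
rewrite -[u :: _]/(pmap (ancestor G u) (iota 0 m.+1)).
(* The path above [u] ends before height [m], so this last height contributes nothing. *)
have -> : iota 0 m.+1 = iota 0 m ++ [:: m] by rewrite -addn1 iotaD.
rewrite pmap_cat /= top_u cats0.
rewrite (iotaDl 1 0); elim: (iota 0 m) => //= i s ->.
by rewrite -[obind _ _]/(ancestor G v i.+1) ancestorS Gv.
Qed.

Lemma avoids_decreasingP :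
  reflect (forall v u w, F v = Some u -> F u = Some w -> v < u)
          (all (avoids F) [:: [:: 3; 1; 2]; [:: 2; 1; 3]; [:: 1; 2; 3]]).
Proof.
apply: (iffP idP) => [av v u w Fv Fu|dec].
  (* Otherwise the labels of [w], [u], [v] end in an ascent and form one of the patterns. *)
  rewrite ltnNge; apply/negP => le_uv.
  have uv : u != v by have := ancestor_acyclic v 0; rewrite /= Fv.
  have wu : w != u by have := ancestor_acyclic u 0; rewrite /= Fu.
  have wv : w != v by have := ancestor_acyclic v 1; rewrite /= Fv /= Fu.
  have sub : subseq [:: val w; val u; val v] (root_path F v).
    rewrite (root_path_child Fv) (root_path_child Fu).
    rewrite -[[:: _; _; _]]/(rcons (rcons [:: val w] u) v).
    rewrite -!cats1; do 2!apply: cat_subseq => //.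
    case: (F w) (@root_path_root w) (@root_path_child w) => [x _ | -> //].
      by move/(_ x erefl) ->; rewrite -cats1 suffix_subseq ?suffix_suffix.
  have nord sigma : sigma \in [:: [:: 3; 1; 2]; [:: 2; 1; 3]; [:: 1; 2; 3]] ->
      ~~ same_relative_order [:: val w; val u; val v] sigma.
    move=> /(allP av)/forallP/(_ v); apply: contra => ord.
    by apply/contains_patternP; exists [:: val w; val u; val v].
  have := (nord [:: 3; 1; 2] isT, nord [:: 2; 1; 3] isT, nord [:: 1; 2; 3] isT).
  rewrite !same_relative_order3 /=.
  have {}uv : u < v by rewrite ltn_neqAle uv.
  rewrite -!(inj_eq val_inj) in wu wv; rewrite uv [v < u]ltnNge le_uv /=.
  case: (ltngtP w u) wu => // lt_wu _; case: (ltngtP w v) wv => // lt_wv _;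
    first [by case=> -[] | lia].
(* Here [x] is the root; [last x s = v] supplies the label with which the next one down is
   compared. *)
have path_dec v :
    exists x s, root_path F v = x :: s /\ sorted gtn s /\ last x s = v.
  have [k] : exists k, ancestor F v k = None by exists n; apply: ancestor_size.
  elim: k v => [//|k IHk] v; rewrite ancestorS.
  case Fv: (F v) => [u|] /=; last by exists v, [::]; rewrite root_path_root.
  move/IHk => [x [s [def_u [dec_s last_s]]]]; exists x, (rcons s v).
  rewrite (root_path_child Fv) def_u last_rcons; do 2!split=> //.
  case: s def_u dec_s last_s => // y s def_u /= dec_s last_s.
  rewrite rcons_path dec_s /= last_s.
  case Fu: (F u) => [w|]; first exact: dec Fv Fu.
  by rewrite root_path_root in def_u.
apply/allP => sigma sig_in; apply/forallP => v.
apply/contains_patternP => -[t sub_t ord_t].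
have : size t = 3.
  move/andP: ord_t => [/eqP-> _].
  by move: sig_in; rewrite !inE => /or3P[] /eqP ->.
case: t sub_t ord_t => [|a [|b [|c [|]]]] // sub_t ord_t _.
have lt_bc : b < c.
  move: sig_in ord_t; rewrite !inE => /or3P[] /eqP ->;
    rewrite same_relative_order3 /=; lia.
have [x [s [def_s [dec_s _]]]] := path_dec v.
(* Only [a] can be the root, so the ascent [b < c] lies in the decreasing part. *)
have sub_bc : subseq [:: b; c] s.
  move: sub_t; rewrite def_s /=; case: eqP => // _.
  by apply: subseq_trans; apply: subseq_cons.
have := subseq_sorted (rev_trans ltn_trans) sub_bc dec_s.
by rewrite /= andbT ltnNge ltnW.
Qed.

End Forest.

(** * Counting avoiding forests by root set *)

(** The minimum of [A] has all other elements above it, and removing it changes no other factor. *)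
Lemma prod_rank n (A : {set 'I_n}) r :
  \prod_(v in A) (r + #|[set u in A | v < u]|) = \prod_(i < #|A|) (r + i).
Proof.
elim: {A}#|A| {-2}A (erefl #|A|) => [|m IHm] A cardA.
  by rewrite (cards0_eq cardA) big_set0 cards0 big_ord0.
have [v0 Av0] : exists v, v \in A by apply/set0Pn; rewrite -card_gt0 cardA.
case: (arg_minnP (fun v : 'I_n => v : nat) Av0) => v Av' min_v {v0 Av0}.
have {Av'} Av : v \in A by [].
have cardAv : #|A :\ v| = m by move: cardA; rewrite (cardsD1 v A) Av => -[].
have := IHm _ cardAv; rewrite cardAv => prod_m.
rewrite (big_setD1 v Av) cardA big_ord_recr /= -prod_m mulnC.
congr (_ * (r + _)).
  apply: eq_bigr => u /setD1P[neq_uv Au]; congr (r + #|pred_of_set _|).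
  apply/setP => w; rewrite !inE; case: eqP => //= ->.
  by rewrite Av /= ltnNge min_v.
rewrite -cardAv; apply: eq_card => u; rewrite !inE.
case: eqP => [->|/eqP neq_uv] /=; first by rewrite ltnn andbF.
case Au: (u \in A) => //=; rewrite ltn_neqAle min_v // andbT.
by rewrite eq_sym.
Qed.

Section Count.
Variable n : nat.
Implicit Types (p : {ffun 'I_n -> option 'I_n}) (R : {set 'I_n}).

Definition roots_of p : {set 'I_n} := [set v | p v == None].

(* The values [p v] allowed when [p] is an avoiding forest with root set [R]. *)
Definition admissible R (v : 'I_n) : pred (option 'I_n) :=
  fun o => if o is Some u then (v \notin R) && ((u \in R) || (v < u))
           else v \in R.

(** Labels increase on the way up through non-roots, so every climb reaches a root. *)
Lemma admissible_forest p :
  0 < n -> p \in family (admissible (roots_of p)) -> is_forest p.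
Proof.
move=> n_gt0 /familyP adm.
set R := roots_of p in adm.
(* [h v] bounds the number of vertices on the path from v to its root. *)
pose h (v : 'I_n) := if v \in R then 1 else #|[set w in ~: R | v <= w]|.+1.
have anc k v : h v <= k -> ancestor p v k = None.
  elim: k v => [|k IHk] v; first by rewrite /h; case: ifP.
  rewrite ancestorS; have := adm v; rewrite /admissible unfold_in.
  case pv: (p v) => [u|] //= /andP[rv /orP[ru|lt_vu]] le_hv;
    apply: IHk; rewrite -ltnS; apply: leq_trans le_hv.
    rewrite /h ru (negPf rv) ltnS card_gt0.
    by apply/set0Pn; exists v; rewrite !inE in rv *; rewrite rv leqnn.
  rewrite /h (negPf rv) ltnS.
  have v_in : v \in [set w in ~: R | v <= w] by rewrite inE in_setC rv /=.
  case: ifP => _; first by rewrite card_gt0; apply/set0Pn; exists v.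
  apply/proper_card/properP; split; last first.
    by exists v; rewrite // inE leqNgt lt_vu andbF.
  by apply/subsetP => w; rewrite !inE => /andP[-> /(leq_trans (ltnW lt_vu)) ->].
(* The largest label has no larger parent, so it is a root or hangs from one. One root suffices for
   [h v <= n]. *)
have [r Rr] : exists r, r \in R.
  have [v v_max] : exists v : 'I_n, v.+1 = n.
    by case: (n) n_gt0 => // m _; exists ord_max.
  have := adm v; rewrite /admissible unfold_in.
  case: (p v) => [u /andP[_ /orP[ru|]]|rv]; first by exists u.
    by rewrite ltnNge -ltnS v_max ltn_ord.
  by exists v.
apply/forallP => v; apply/eqP/anc; rewrite /h; case: ifP => // _.
rewrite -[X in _ <= X]card_ord -(cardsC R) -add1n leq_add //.
  by rewrite card_gt0; apply/set0Pn; exists r.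
by apply/subset_leq_card/subsetP => w; rewrite inE => /andP[].
Qed.

Lemma card_admissible R v :
  #|admissible R v| = if v \in R then 1 else #|R| + #|[set u in ~: R | v < u]|.
Proof.
have [Rv|Rv] := boolP (v \in R).
  rewrite -(card1 (None : option 'I_n)); apply: eq_card => -[u|];
    by rewrite [LHS]unfold_in /= Rv inE.
have disj : [disjoint R & [set u in ~: R | v < u]].
  by rewrite -setI_eq0; apply/eqP/setP => w; rewrite !inE; case: (w \in R).
have [_] := leq_card_setU R [set u in ~: R | v < u]; rewrite disj => /eqP <-.
rewrite -(card_imset _ Some_inj); apply: eq_card => -[u|].
  rewrite (mem_imset _ _ Some_inj) unfold_in /= Rv !inE.
  by case: (u \in R).
by rewrite unfold_in /= (negPf Rv); apply/esym/imsetP => -[].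
Qed.

Lemma decreasing_admissible p :
  (forall v u w, p v = Some u -> p u = Some w -> v < u) <->
  p \in family (admissible (roots_of p)).
Proof.
split=> [dec|/familyP adm v u w pv pu].
  apply/familyP => v; rewrite /admissible unfold_in.
  case pv: (p v) => [u|]; rewrite !inE pv //=.
  by case pu: (p u) => [w|] //=; apply: dec pv pu.
by have := adm v; rewrite /admissible unfold_in pv !inE pv pu.
Qed.

(** For empty [R] and n > 0 both sides are 0, so all sets [R] can be summed over alike. *)
Lemma card_family_admissible R :
  #|family (admissible R)| = n.-1 ^_ (n - #|R|).
Proof.
rewrite card_family foldrE big_map big_enum /=.
rewrite (eq_bigr _ (fun v _ => card_admissible R v)).
rewrite (bigID (mem R)) /= big1 => [|v ->] //; rewrite mul1n.
under eq_bigr => v /negPf -> do [].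
rewrite (eq_bigl (mem (~: R))) => [|v]; last by rewrite !inE.
by rewrite prod_rank rising_ffact cardsC card_ord cardsCs setCK card_ord.
Qed.

(** Hence the families of distinct root sets are disjoint. *)
Lemma roots_of_admissible p R : p \in family (admissible R) -> roots_of p = R.
Proof.
move=> /familyP adm; apply/setP => v; have := adm v.
by rewrite /admissible unfold_in inE; case: (p v) => [u /andP[/negPf->]|->].
Qed.

Lemma num_avoiding_forestsE : 0 < n ->
  num_avoiding_forests n [:: [:: 3; 1; 2]; [:: 2; 1; 3]; [:: 1; 2; 3]] =
  \sum_(r < n.+1) 'C(n, r) * n.-1 ^_ (n - r).
Proof.
move=> n_gt0; rewrite /num_avoiding_forests.
rewrite -(card_imset _ (val_inj : injective (@parent n))).
set S := _ @: _.
have -> : #|S| = \sum_(R : {set 'I_n}) #|family (admissible R)|.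
  rewrite -sum1_card (partition_big roots_of predT) //=.
  apply: eq_bigr => R _; rewrite sum1dep_card; apply: eq_card => p.
  rewrite inE; apply/andP/idP => [[/imsetP[F + ->] /eqP <-]|adm].
    by rewrite inE => /avoids_decreasingP/decreasing_admissible.
  have rootsE := roots_of_admissible adm; rewrite rootsE eqxx; split=> //.
  rewrite -{R}rootsE in adm *.
  apply/imsetP; exists (Forest (admissible_forest n_gt0 adm)) => //.
  by rewrite inE; apply/avoids_decreasingP/decreasing_admissible.
rewrite (partition_big (fun R : {set 'I_n} => inord #|R| : 'I_n.+1) predT) //=.
apply: eq_bigr => r _.
have cardR (R : {set 'I_n}) : (inord #|R| == r) = (#|R| == r).
  by rewrite -val_eqE /= inordK // ltnS -[X in _ <= X]card_ord max_card.
rewrite (eq_bigl _ _ cardR) (eq_bigr (fun=> n.-1 ^_ (n - r))) => [|R /eqP <-].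
  by rewrite sum_nat_cond_const card_draws card_ord.
exact: card_family_admissible.
Qed.

End Count.

(** * Stirling numbers and the final comparison *)

Lemma sum_fiber_card (T : finType) (f : T -> nat) (F : nat -> nat) m :
  (forall t, f t < m) ->
  \sum_t F (f t) = \sum_(k < m) #|[set t | f t == k]| * F k.
Proof.
move=> f_lt; rewrite (partition_big (fun t => Ordinal (f_lt t)) predT) //=.
apply: eq_bigr => k _; rewrite -sum_nat_cond_const.
rewrite (eq_bigl (fun t => f t == k)) => [|t]; last by rewrite -val_eqE.
by apply: eq_bigr => t /eqP ->.
Qed.

Lemma card_partition_le (T : finType) (P : {set {set T}}) :
  partition P [set: T] -> #|P| <= #|T|.
Proof.
move=> partP; rewrite -(card_transversal (transversalP partP)).
exact: max_card.
Qed.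

Definition stirling2 k r :=
  #|[set P : {set {set 'I_k}} | partition P [set: 'I_k] && (#|P| == r)]|.

(** Leaving [m] free lets one range of r serve every k, so that the sums over k and r can be
    exchanged. *)
Lemma sum_stirling2 k m (F : nat -> nat) : k < m ->
  \sum_(P : {set {set 'I_k}} | partition P [set: 'I_k]) F #|P| =
  \sum_(r < m) stirling2 k r * F r.
Proof.
move=> lt_km.
have P_lt (P : {set {set 'I_k}}) : partition P [set: 'I_k] -> #|P| < m.
  by move/card_partition_le; rewrite card_ord => /leq_ltn_trans; apply.
case: m lt_km P_lt => // m _ P_lt.
rewrite (partition_big
  (fun P : {set {set 'I_k}} => inord #|P| : 'I_m.+1) predT) //=.
apply: eq_bigr => r _; rewrite -sum_nat_cond_const.
apply: eq_big => [P|P /andP[partP /eqP <-]]; last by rewrite inordK ?P_lt.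
case partP: (partition P _) => //=.
by rewrite -val_eqE /= inordK ?P_lt.
Qed.

Theorem theorem5p2 (n : nat) (hn : 1 <= n) :
  num_avoiding_forests n [:: [:: 3; 1; 2]; [:: 2; 1; 3]; [:: 1; 2; 3]] =
  \sum_(1 <= k < n.+1) bell k * stirling1 n k.
Proof.
have cycles_le (s : 'S_n) : #|porbits s| < n.+1.
  by rewrite ltnS -[X in _ <= X]card_ord leq_imset_card.
have bellE k : k < n.+1 -> bell k = \sum_(r < n.+1) stirling2 k r.
  move=> lt_k; have := sum_stirling2 (fun=> 1) lt_k.
  by rewrite sum1dep_card -/(bell k) => ->;
    apply: eq_bigr => r _; rewrite muln1.
(* As n >= 1, every permutation has a cycle; the sum may thus start at k = 0. *)
have stir0 : stirling1 n 0 = 0.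
  apply/eqP; rewrite cards_eq0; apply/eqP/setP => s; rewrite !inE cards_eq0.
  apply/negP => /eqP/setP/(_ (porbit s (Ordinal hn))).
  by rewrite inE imset_f.
rewrite num_avoiding_forestsE //.
have -> : \sum_(1 <= k < n.+1) bell k * stirling1 n k =
    \sum_(k < n.+1) bell k * stirling1 n k.
  rewrite -(big_mkord xpredT (fun k => bell k * stirling1 n k)).
  by rewrite [RHS]big_ltn // stir0 muln0.
rewrite [RHS](eq_bigr (fun k : 'I_n.+1 =>
  \sum_(r < n.+1) stirling1 n k * stirling2 k r)); last first.
  by move=> k _; rewrite mulnC bellE // big_distrr.
rewrite [RHS]exchange_big /=; apply: eq_bigr => -[r lt_r] _ /=.
apply: (falling_basis_inj (a := fun r => 'C(n, r) * n.-1 ^_ (n - r))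
  (b := fun r => \sum_(k < n.+1) stirling1 n k * stirling2 k r) _ lt_r) => x.
(* Both sides expand x (x+1) ... (x+n-1) in falling factorials of x, the right one through its
   powers x^k. *)
rewrite -rising_to_falling // -sum_exp_card_porbits.
rewrite (sum_fiber_card (fun k => x ^ k) cycles_le).
under [RHS]eq_bigr => i _ do rewrite big_distrl.
rewrite exchange_big /=; apply: eq_bigr => k _.
(* Now x^k counts the functions from ['I_k] to ['I_x], sorted by their fibers. *)
rewrite -[k in x ^ k]card_ord -sum_ffact_card_partition.
rewrite (sum_stirling2 _ (ltn_ord k)).
by rewrite big_distrr; apply: eq_bigr => i _; rewrite /= mulnA.
Qed.
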